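(* For every integer $n \ge 4$, $\chi_{la}(P_n \circ K_1) = n+2$, where $P_n$ is the path on $n$ vertices.
   Context: Let $G=(V,E)$ be a finite simple undirected graph with no component isomorphic to $K_2$. A bijection $f : E \to \{1,2,\dots,|E|\}$ is a local antimagic labeling of $G$ if $w(u)\ne w(v)$ for every pair of adjacent vertices $u,v$, where $w(u)=\sum_{e\in E(u)} f(e)$ and $E(u)$ is the set of edges incident to $u$. Such an $f$ induces the proper vertex coloring $v\mapsto w(v)$, which uses $|\{w(v): v\in V\}|$ colors. The local antimagic chromatic number $\chi_{la}(G)$ is the minimum number of colors used over all colorings induced by local antimagic labelings of $G$ (so $\chi_{la}(G)\le k$ means that there is a local antimagic labeling inducing at most $k$ colors). The corona product $G\circ H$ is obtained from one copy of $G$ and $|V(G)|$ copies of $H$ by joining the $i$-th vertex of $G$ to every vertex of the $i$-th copy of $H$, for $1\le i\le |V(G)|$. *)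

(* Defs.v *)
From mathcomp Require Import all_boot.

Set Implicit Arguments.
Unset Strict Implicit.
Unset Printing Implicit Defensive.

Record sgraph := SGraph {
  vertex :> finType;
  adj : rel vertex;
  adj_sym : symmetric adj;
  adj_irrefl : irreflexive adj
}.

Definition edges (G : sgraph) : {set {set G}} :=
  [set e : {set G} | [exists x, exists y, adj x y && (e == [set x; y])]].

Definition incident_edges (G : sgraph) (v : G) : {set {set G}} :=
  [set e in edges G | v \in e].

Definition weight (G : sgraph) (f : {set G} -> nat) (v : G) : nat :=
  \sum_(e in incident_edges v) f e.

(* A labeling is a function on all sets of vertices; only its values on edges
   matter. *)
Definition edge_bijection (G : sgraph) (f : {set G} -> nat) : Prop :=
  [/\ {in edges G, forall e, 1 <= f e <= #|edges G|},
      {in edges G &, injective f}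
    & forall k, 1 <= k <= #|edges G| -> exists2 e, e \in edges G & f e = k].

Definition local_antimagic (G : sgraph) (f : {set G} -> nat) : Prop :=
  edge_bijection f /\ forall u v : G, adj u v -> weight f u <> weight f v.

Definition num_colors (G : sgraph) (f : {set G} -> nat) : nat :=
  size (undup [seq weight f v | v : G]).

(* [is_chi_la G k] says that the local antimagic chromatic number of [G]
   exists and is equal to [k].  It is a relation because a graph may have no
   local antimagic labeling (e.g. K_2), in which case it holds for no [k]. *)
Definition is_chi_la (G : sgraph) (k : nat) : Prop :=
  (exists2 f : {set G} -> nat, local_antimagic f & num_colors f = k) /\
  (forall f : {set G} -> nat, local_antimagic f -> k <= num_colors f).

Section PathGraph.
Variable n : nat.

Definition path_adj : rel 'I_n := fun i j => (i.+1 == j) || (j.+1 == i).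

Lemma path_adj_sym : symmetric path_adj.
Proof. by move=> i j; rewrite /path_adj orbC. Qed.

Lemma path_adj_irrefl : irreflexive path_adj.
Proof. by move=> i; rewrite /path_adj orbb gtn_eqF. Qed.

Definition path_graph : sgraph := SGraph path_adj_sym path_adj_irrefl.
End PathGraph.

Section CompleteGraph.
Variable n : nat.

Definition complete_adj : rel 'I_n := fun i j => i != j.

Lemma complete_adj_sym : symmetric complete_adj.
Proof. by move=> i j; rewrite /complete_adj eq_sym. Qed.

Lemma complete_adj_irrefl : irreflexive complete_adj.
Proof. by move=> i; rewrite /complete_adj eqxx. Qed.

Definition complete_graph : sgraph :=
  SGraph complete_adj_sym complete_adj_irrefl.
End CompleteGraph.

Section Corona.
Variables G H : sgraph.

(* [inr (x, a)] is the vertex [a] of the copy of [H] attached to [x]. *)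
Definition corona_adj : rel (G + G * H) := fun p q =>
  match p, q with
  | inl x, inl y => adj x y
  | inl x, inr (y, _) => x == y
  | inr (x, _), inl y => x == y
  | inr (x, a), inr (y, b) => (x == y) && adj a b
  end.

Lemma corona_adj_sym : symmetric corona_adj.
Proof.
move=> [x|[x a]] [y|[y b]] /=; first exact: adj_sym.
- exact: eq_sym.
- exact: eq_sym.
- by rewrite eq_sym adj_sym.
Qed.

Lemma corona_adj_irrefl : irreflexive corona_adj.
Proof. by move=> [x|[x a]] /=; rewrite ?adj_irrefl ?andbF. Qed.

Definition corona : sgraph := SGraph corona_adj_sym corona_adj_irrefl.
End Corona.

(* Main.v *)
(* Let N = 2n - 1 be the number of edges of the comb.  The n leaf colors are
   distinct labels, hence at most N.  If no two adjacent spine vertices had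
   weight above N, charge to every spine vertex its weight when this is at most
   N and its pendant label otherwise: each label would be charged at least once,
   so the charges would sum to at least 1 + ... + N = nN, and every charge would
   be exactly N.  The label N would then be pendant at one end of each spine
   edge, which is absurd for n >= 4.  So two colors exceed N.

   For the upper bound, number the spine from 0 and let the spine labels zigzag,
   so that the sums of consecutive ones increase by 1; decreasing pendant labels
   compensate for this, and interior spine vertices get only two weights,
   2n + n/2 and 2n + n/2 + 2.  Both end weights fall in [n, N], the set of
   pendant labels. *)
Require Import Defs.
From mathcomp Require Import all_boot.
From mathcomp Require Import zify.

Set Implicit Arguments.
Unset Strict Implicit.
Unset Printing Implicit Defensive.

(** * The total of the labels, in any graph *)

Lemma sum_edge_labels (G : sgraph) (f : {set G} -> nat) :
  edge_bijection f ->
  (\sum_(e in edges G) f e).*2 = #|edges G| * #|edges G|.+1.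
Proof.
move=> [f_rng f_inj f_surj]; set N := #|_| in f_rng f_surj *.
have labels_perm : perm_eq [seq f e | e <- enum (edges G)] (iota 1 N).
  apply: uniq_perm; first 1 last; [exact: iota_uniq | |].
  - move=> k; rewrite mem_iota add1n ltnS.
    apply/mapP/idP => [[e]|/f_surj[e eE <-]].
      by rewrite mem_enum => /f_rng ? ->.
    by exists e; rewrite ?mem_enum.
  - rewrite map_inj_in_uniq ?enum_uniq // => x y.
    by rewrite !mem_enum; apply: f_inj.
rewrite -big_enum /= -(big_map f xpredT id) (perm_big _ labels_perm) /=.
rewrite -[X in iota _ X](subn1 N.+1) -/(index_iota 1 N.+1).
elim: (N) => [|k IHk]; first by rewrite big_geq.
by rewrite big_nat_recr //= doubleD IHk; lia.
Qed.

(** * The comb on [m.+1] spine vertices: its edges and adjacency *)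

Section Comb.
Variable m : nat.

Notation comb := (corona (path_graph m.+1) (complete_graph 1)).

Definition spine (i : 'I_m.+1) : comb := inl i.
Definition leaf (i : 'I_m.+1) : comb := inr (i, ord0).

Definition tail (k : 'I_m) : 'I_m.+1 := widen_ord (leqnSn m) k.
Definition head (k : 'I_m) : 'I_m.+1 := lift ord0 k.

(** Pendant edges are indexed by spine vertices and spine edges by their left ends, so that sums
    over edges split into two ordinal sums. *)
Definition comb_edge (x : 'I_m.+1 + 'I_m) : {set comb} :=
  match x with
  | inl i => [set spine i; leaf i]
  | inr k => [set spine (tail k); spine (head k)]
  end.

Lemma combP (v : comb) : (exists i, v = spine i) \/ (exists i, v = leaf i).
Proof.
case: v => [i|[i a]]; first by left; exists i.
by right; exists i; rewrite /leaf (ord1 a).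
Qed.

Lemma spine_in_comb_edge (j : 'I_m.+1) x : (spine j \in comb_edge x) =
  match x with inl i => j == i | inr k => (j == tail k) || (j == head k) end.
Proof. by case: x => [i|k]; rewrite !inE // orbF. Qed.

Lemma leaf_in_comb_edge (j : 'I_m.+1) x :
  (leaf j \in comb_edge x) = if x is inl i then j == i else false.
Proof.
by case: x => [i|k]; rewrite !inE //=; apply/eqP/eqP => [[->]|->].
Qed.

Lemma head_tail k : (head k == tail k) = false.
Proof. by apply/negbTE; rewrite -val_eqE /= /bump /=; lia. Qed.

Lemma comb_edge_inj : injective comb_edge.
Proof.
(* The ends of a spine edge are consecutive, so if both ends of edge [k] lie on edge [l], the edges
   coincide. A pendant edge is recognized by its leaf alone. *)
have tailE k l : (tail k == tail l) || (tail k == head l) ->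
    (head k == tail l) || (head k == head l) -> k = l.
  rewrite -!val_eqE /= /bump /= => H1 H2; apply: val_inj => /=; lia.
move=> [i|k] [j|l] /setP E.
- by have := E (leaf i); rewrite !leaf_in_comb_edge eqxx => /esym/eqP ->.
- by have := E (leaf i); rewrite !leaf_in_comb_edge eqxx.
- by have := E (leaf j); rewrite !leaf_in_comb_edge eqxx.
- congr inr; have := E (spine (tail k)); have := E (spine (head k)).
  rewrite !spine_in_comb_edge !eqxx orbT /= => /esym H1 /esym H2.
  exact: tailE.
Qed.

Lemma adj_spine_leaf i : adj (spine i) (leaf i).
Proof. exact: eqxx. Qed.

Lemma adj_tail_head k : adj (spine (tail k)) (spine (head k)).
Proof. by rewrite /= /path_adj /= /bump /= add1n eqxx. Qed.

Lemma comb_adjP (u v : comb) : adj u v ->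
  [\/ exists i, (u = spine i /\ v = leaf i) \/ (u = leaf i /\ v = spine i)
    | exists k, (u = spine (tail k) /\ v = spine (head k)) \/
                (u = spine (head k) /\ v = spine (tail k))].
Proof.
have stepP (i j : 'I_m.+1) : i.+1 == j -> exists k, i = tail k /\ j = head k.
  move=> ij; have im : i < m by rewrite -ltnS (eqP ij).
  by exists (Ordinal im); split; apply: val_inj => //=; rewrite /bump add1n (eqP ij).
case: (combP u) => [[i ->]|[i ->]]; case: (combP v) => [[j ->]|[j ->]] //=.
- by case/orP => /stepP[k [-> ->]]; right; exists k; [left|right].
- by move/eqP=> ->; left; exists j; left.
- by move/eqP=> ->; left; exists j; right.
- by rewrite /complete_adj eqxx andbF.
Qed.

Lemma edges_comb : edges comb = [set comb_edge x | x : 'I_m.+1 + 'I_m].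
Proof.
apply/setP => e; rewrite inE; apply/idP/imsetP => [|[x _ ->]].
  case/existsP => u /existsP[v /andP[/comb_adjP uv /eqP ->]].
  case: uv => -[i [[-> ->]|[-> ->]]]; [| rewrite setUC | | rewrite setUC];
    by [exists (inl i) | exists (inr i)].
case: x => [i|k]; apply/existsP.
  by exists (spine i); apply/existsP; exists (leaf i); rewrite adj_spine_leaf eqxx.
exists (spine (tail k)); apply/existsP; exists (spine (head k)).
by rewrite adj_tail_head eqxx.
Qed.

Lemma comb_edge_edges x : comb_edge x \in edges comb.
Proof. by rewrite edges_comb imset_f. Qed.

Lemma card_edges_comb : #|edges comb| = m.*2.+1.
Proof.
by rewrite edges_comb card_imset ?card_sum ?card_ord; [lia | exact: comb_edge_inj].
Qed.

Lemma big_comb_edges (P : pred {set comb}) (F : {set comb} -> nat) :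
  \sum_(e in edges comb | P e) F e =
  \sum_(i | P (comb_edge (inl i))) F (comb_edge (inl i)) +
  \sum_(k | P (comb_edge (inr k))) F (comb_edge (inr k)).
Proof.
rewrite edges_comb big_mkcondr big_imset /=; last by move=> x y _ _; apply: comb_edge_inj.
by rewrite big_sumType /= -!big_mkcond.
Qed.

(** * Weights under an arbitrary labeling, and the lower bound *)

Section Labeling.
Variable f : {set comb} -> nat.

Lemma weightE (v : comb) : weight f v = \sum_(e in edges comb | v \in e) f e.
Proof. by apply: eq_bigl => e; rewrite !inE. Qed.

Lemma weight_leaf i : weight f (leaf i) = f (comb_edge (inl i)).
Proof.
rewrite weightE big_comb_edges.
under eq_bigl => j do rewrite leaf_in_comb_edge eq_sym.
rewrite big_pred1_eq big_pred0 ?addn0 // => k.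
by rewrite leaf_in_comb_edge.
Qed.

Lemma weight_spine i : weight f (spine i) = f (comb_edge (inl i)) +
  \sum_(k | (i == tail k) || (i == head k)) f (comb_edge (inr k)).
Proof.
rewrite weightE big_comb_edges.
under eq_bigl => j do rewrite spine_in_comb_edge eq_sym.
rewrite big_pred1_eq; congr addn.
by apply: eq_bigl => k; rewrite spine_in_comb_edge.
Qed.

Lemma heavy_spine_edge : 3 <= m -> local_antimagic f -> exists k : 'I_m,
  m.*2.+1 < weight f (spine (tail k)) /\ m.*2.+1 < weight f (spine (head k)).
Proof.
move=> m3 [fbij fproper]; set N := m.*2.+1.
pose light i := weight f (spine i) <= N.
suff /existsP[k] : [exists k, ~~ light (tail k) && ~~ light (head k)].
  by rewrite /light -!ltnNge => /andP[]; exists k.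
apply: contraT => /existsPn no_heavy; exfalso.
have pendant_rng i : 0 < f (comb_edge (inl i)) <= N.
  by case: fbij => + _ _; rewrite card_edges_comb; apply; apply: comb_edge_edges.
pose charge i := if light i then weight f (spine i) else f (comb_edge (inl i)).
have charge_le i : charge i <= N.
  by rewrite /charge; case: ifP => // _; case/andP: (pendant_rng i).
have total_le : \sum_(e in edges comb) f e <= \sum_i charge i.
  rewrite (eq_bigl (fun e => (e \in edges comb) && true)); last first.
    by move=> e; rewrite andbT.
  rewrite (big_comb_edges xpredT).
  have -> : \sum_i charge i = \sum_i f (comb_edge (inl i)) +
    \sum_i \sum_(k | light i && ((i == tail k) || (i == head k))) f (comb_edge (inr k)).
    rewrite -big_split /=; apply: eq_bigr => i _.
    rewrite /charge weight_spine; case: (light i) => //=.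
    by rewrite big_pred0_eq addn0.
  (* Pendant labels are charged in either case and cancel. After exchanging the sums, a spine label
     is counted once per light end of its edge, and [no_heavy] provides such an end. *)
  rewrite leq_add2l (exchange_big_dep xpredT) //=; apply: leq_sum => k _.
  rewrite sum_nat_const leq_pmull //; apply/card_gt0P.
  have := no_heavy k; rewrite negb_and !negbK => /orP[lt|lh].
    by exists (tail k); rewrite -topredE /= lt eqxx.
  by exists (head k); rewrite -topredE /= lh eqxx orbT.
have charge_eq i : charge i = N.
  have [_ /esym] := leqif_sum (fun i (_ : true) => leqif_eq (charge_le i)).
  suff -> : \sum_i charge i == \sum_(i < m.+1) N.
    by move/forallP/(_ i)/eqP.
  (* Since N + 1 = 2(m + 1), the labels sum to N(N + 1)/2 = N(m + 1), which leaves no slack in any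
     charge. *)
  rewrite eqn_leq leq_sum //= (leq_trans _ total_le) //.
  have := sum_edge_labels fbij; rewrite card_edges_comb -/N sum_nat_const card_ord.
  rewrite /N; set S := \sum_(_ in _) _; nia.
have one_heavy (k : 'I_m) : light (tail k) != light (head k).
  (* Two heavy ends are excluded by [no_heavy]; two light ends would both have weight N, against
     properness. *)
  apply/negP => /eqP E; have := no_heavy k; rewrite E andbb negbK => lh.
  apply: (fproper _ _ (adj_tail_head k)).
  by have := charge_eq (tail k); have := charge_eq (head k); rewrite /charge E lh => -> ->.
have heavy_end (k : 'I_m) : exists2 i : 'I_m.+1,
    (i == tail k) || (i == head k) & f (comb_edge (inl i)) = N.
  have := one_heavy k; have := charge_eq (tail k); have := charge_eq (head k).
  rewrite /charge; case: (light (tail k)); case: (light (head k)) => // H1 H2 _.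
    by exists (head k); rewrite ?eqxx ?orbT.
  by exists (tail k); rewrite ?eqxx.
(* The spine edges 0 and 2 share no vertex, so N would label two distinct pendant edges. Edge 2
   exists because [3 <= m]. *)
have m0 : 0 < m by lia.
have m2 : 2 < m by lia.
have [i iE fi] := heavy_end (Ordinal m0).
have [j jE fj] := heavy_end (Ordinal m2).
have [_ finj _] := fbij.
have /comb_edge_inj [ij] : comb_edge (inl i) = comb_edge (inl j).
  by apply: finj; rewrite ?comb_edge_edges ?fi ?fj.
by move: iE jE; rewrite ij -!val_eqE /= /bump /=; lia.
Qed.

Lemma num_colors_comb_ge : 3 <= m -> local_antimagic f -> m.+3 <= num_colors f.
Proof.
move=> m3 fla; have [k [wt wh]] := heavy_spine_edge m3 fla.
have [[frng finj _] fproper] := fla.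
pose s := weight f (spine (tail k)) :: weight f (spine (head k)) ::
            [seq weight f (leaf i) | i : 'I_m.+1].
have <- : size s = m.+3 by rewrite /= size_map size_enum_ord.
(* A leaf weight is a single label, so the two heavy spine weights are new colors. *)
have not_leaf w : m.*2.+1 < w -> w \notin [seq weight f (leaf i) | i : 'I_m.+1].
  move=> wN; apply/negP => /mapP[i _ wE]; move: wN; rewrite wE weight_leaf.
  have /andP[_] := frng _ (comb_edge_edges (inl i)).
  by rewrite card_edges_comb leqNgt => /negP.
apply: uniq_leq_size => [|w].
  rewrite /s /= inE negb_or !not_leaf // andbT /=; apply/andP; split.
    by apply/eqP; apply: fproper; apply: adj_tail_head.
  rewrite map_inj_uniq ?enum_uniq // => i j; rewrite !weight_leaf => fE.
  by have /comb_edge_inj [] := finj _ _ (comb_edge_edges _) (comb_edge_edges _) fE.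
have wmem v : weight f v \in undup [seq weight f v | v : comb].
  by rewrite mem_undup map_f ?mem_enum.
by rewrite !inE => /or3P[/eqP->|/eqP->|/mapP[i _ ->]].
Qed.

End Labeling.

(** * The zigzag labeling and the upper bound *)

Lemma sum_incident_spine (F : nat -> nat) (i : 'I_m.+1) :
  \sum_(k : 'I_m | (i == tail k) || (i == head k)) F k =
  (if i < m then F i else 0) + (if 0 < i then F i.-1 else 0).
Proof.
rewrite (bigID (fun k => i == tail k)) /=; congr addn.
  rewrite (eq_bigl (fun k => i == tail k)) => [|k]; last by case: (i == tail k); rewrite ?andbF.
  case: ltnP => [im|mi].
    by rewrite (big_pred1 (Ordinal im)) // => k; rewrite eq_sym -!val_eqE.
  by rewrite big_pred0 // => k; rewrite -val_eqE /=; have := ltn_ord k; lia.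
rewrite (eq_bigl (fun k => i == head k)) => [|k]; last first.
  by case: (altP (i =P tail k)) => [->|_]; rewrite ?andbF ?andbT // eq_sym head_tail.
case: ltnP => [i0|i0].
  have im : i.-1 < m by have := ltn_ord i; lia.
  by rewrite (big_pred1 (Ordinal im)) // => k; rewrite /= -!val_eqE /= /bump /=; lia.
by rewrite big_pred0 // => k; rewrite -val_eqE /= /bump /=; lia.
Qed.

(** There are [(m.+1)./2] even positions: they take the smallest labels in increasing order, and the
    odd positions continue from there up to [m]. *)
Definition spine_label (k : nat) : nat := k./2.+1 + odd k * (m.+1)./2.

(* The interior labels swap the members of each pair in the decreasing list
   2n - 1, 2n - 2, ..., so that the weights of the two parity classes differ
   by 2 instead of coinciding; the two ends take the labels left over. *)
Definition pendant_label (i : nat) : nat :=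
  if i == 0 then m.+2 + odd m.+1 else
  if i == m then m.+1 else
  if odd i then m.*2.+1 - i else m.*2.+3 - i.

Definition comb_label (x : 'I_m.+1 + 'I_m) : nat :=
  match x with inl i => pendant_label i | inr k => spine_label k end.

(** The value 0 is a default for sets that are not edges; no weight involves it. *)
Definition comb_labeling (e : {set comb}) : nat :=
  if [pick x | comb_edge x == e] is Some x then comb_label x else 0.

Lemma comb_labelingE x : comb_labeling (comb_edge x) = comb_label x.
Proof.
rewrite /comb_labeling; case: pickP => [y /eqP/comb_edge_inj -> //|/(_ x)].
by rewrite eqxx.
Qed.

Lemma spine_label_rng k : k < m -> 0 < spine_label k <= m.
Proof. rewrite /spine_label; case: (boolP (odd k)) => /=; lia. Qed.

Lemma spine_label_inj k l :
  k < m -> l < m -> spine_label k = spine_label l -> k = l.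
Proof.
rewrite /spine_label.
case: (boolP (odd k)); case: (boolP (odd l)) => /=; lia.
Qed.

Lemma spine_label_sum k : spine_label k + spine_label k.+1 = (m.+1)./2 + k.+2.
Proof. rewrite /spine_label /=; case: (boolP (odd k)) => /=; lia. Qed.

Hypothesis m3 : 3 <= m.

Lemma pendant_label_rng i : i <= m -> m < pendant_label i <= m.*2.+1.
Proof.
rewrite /pendant_label => im; case: (altP (i =P 0)) => i0; first lia.
case: (altP (i =P m)) => i1; first lia.
case: ifP; lia.
Qed.

Lemma pendant_label_inj i j :
  i <= m -> j <= m -> pendant_label i = pendant_label j -> i = j.
Proof.
rewrite /pendant_label => im jm.
case: (altP (i =P 0)) => i0; case: (altP (j =P 0)) => j0;
  case: (altP (i =P m)) => i1; case: (altP (j =P m)) => j1; try lia;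
  case: (boolP (odd i)); case: (boolP (odd j)); lia.
Qed.

Lemma comb_label_rng x : 0 < comb_label x <= m.*2.+1.
Proof.
case: x => [i|k] /=.
  by have := pendant_label_rng (ltn_ord i : i <= m); lia.
by have := spine_label_rng (ltn_ord k); lia.
Qed.

Lemma comb_label_inj : injective comb_label.
Proof.
move=> [i|k] [j|l] /= E.
- by congr inl; apply: val_inj; exact: pendant_label_inj (ltn_ord i) (ltn_ord j) E.
- by have := pendant_label_rng (ltn_ord i : i <= m); have := spine_label_rng (ltn_ord l); lia.
- by have := pendant_label_rng (ltn_ord j : j <= m); have := spine_label_rng (ltn_ord k); lia.
- by congr inr; apply: val_inj; exact: spine_label_inj (ltn_ord k) (ltn_ord l) E.
Qed.

Lemma comb_labeling_bijection : edge_bijection comb_labeling.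
Proof.
split.
- move=> e; rewrite card_edges_comb edges_comb => /imsetP[x _ ->].
  by rewrite comb_labelingE comb_label_rng.
- move=> e e'; rewrite edges_comb => /imsetP[x _ ->] /imsetP[y _ ->].
  by rewrite !comb_labelingE => /comb_label_inj ->.
- move=> k; rewrite card_edges_comb => k_rng.
  (* Surjectivity by counting: the labels are distinct members of a list of the same length. *)
  have lab_sub : {subset [seq comb_label x | x : 'I_m.+1 + 'I_m] <= iota 1 m.*2.+1}.
    by move=> _ /mapP[x _ ->]; rewrite mem_iota add1n ltnS comb_label_rng.
  have [|//|_ /(_ k)] := uniq_min_size _ lab_sub.
  + by rewrite map_inj_uniq ?enum_uniq //; apply: comb_label_inj.
  + by rewrite size_iota size_map -cardE card_sum !card_ord; lia.
  rewrite mem_iota add1n ltnS k_rng => /mapP[x _ ->].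
  by exists (comb_edge x); rewrite ?comb_edge_edges ?comb_labelingE.
Qed.

Lemma weight_leaf_comb i : weight comb_labeling (leaf i) = pendant_label i.
Proof. by rewrite weight_leaf comb_labelingE. Qed.

(** At an interior vertex the two spine labels add up to [(m.+1)./2 + i.+1], whose [i] cancels the
    one subtracted in the pendant label; only the parity of [i] remains. *)
Lemma weight_spine_comb (i : 'I_m.+1) : weight comb_labeling (spine i) =
  if i == 0 :> nat then m.+3 + odd m.+1 else
  if i == m :> nat then m.+1 + spine_label m.-1 else
  m.*2.+2 + (m.+1)./2 + (~~ odd i).*2.
Proof.
rewrite weight_spine comb_labelingE.
under eq_bigr => k _ do rewrite comb_labelingE.
rewrite (sum_incident_spine spine_label) /=.
have im : i <= m by rewrite -ltnS.
rewrite /pendant_label; case: (altP (nat_of_ord i =P 0)) => [->|i0].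
  by rewrite /spine_label; case: ltnP => /=; lia.
have -> : (0 < i) by lia.
case: (altP (nat_of_ord i =P m)) => [->|i1]; first by rewrite ltnn.
have im' : i < m by lia.
have := spine_label_sum i.-1; rewrite prednK; last lia.
rewrite im'; case: (boolP (odd i)) => /=; lia.
Qed.

(** A spine vertex outweighs its leaf by its spine labels. Adjacent interior vertices differ in
    parity, and both end weights stay at most [m.*2.+1], below every interior weight. *)
Lemma comb_labeling_antimagic : local_antimagic comb_labeling.
Proof.
split; first exact: comb_labeling_bijection.
have leaf_lt i : weight comb_labeling (leaf i) < weight comb_labeling (spine i).
  rewrite weight_leaf_comb weight_spine_comb /pendant_label.
  have := spine_label_rng (k := m.-1).
  case: (altP (nat_of_ord i =P 0)) => i0; first lia.
  case: (altP (nat_of_ord i =P m)) => i1; first lia.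
  by case: ifP; lia.
have spine_neq k : weight comb_labeling (spine (tail k)) <>
                   weight comb_labeling (spine (head k)).
  rewrite !weight_spine_comb /= /bump /= add1n /=.
  have := spine_label_rng (k := m.-1); have := ltn_ord k.
  case: (altP (nat_of_ord k =P 0)) => k0; case: (altP (k.+1 =P m)) => k1;
    case: (altP (nat_of_ord k =P m)) => k2; lia.
move=> u v /comb_adjP[[i [[-> ->]|[-> ->]]]|[k [[-> ->]|[-> ->]]]].
- by have := leaf_lt i; lia.
- by have := leaf_lt i; lia.
- exact: spine_neq.
- by move=> E; apply: (spine_neq k).
Qed.

Lemma num_colors_comb_labeling : num_colors comb_labeling <= m.+3.
Proof.
(* The two interior weights, then the interval from [m.+1] to [m.*2.+1], which holds the leaf
   weights and both end weights. *)
pose s := m.*2.+2 + (m.+1)./2 :: m.*2.+4 + (m.+1)./2 :: iota m.+1 m.+1.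
have <- : size s = m.+3 by rewrite /= size_iota.
apply: uniq_leq_size => [|w]; first exact: undup_uniq.
rewrite mem_undup => /mapP[v _ ->]; rewrite !inE mem_iota.
case: (combP v) => [[i ->]|[i ->]].
  rewrite weight_spine_comb; have := spine_label_rng (k := m.-1).
  rewrite /spine_label; case: ifP => i0; first lia.
  case: ifP => i1; first lia.
  by case: (odd i) => /=; lia.
by rewrite weight_leaf_comb; have := pendant_label_rng (ltn_ord i : i <= m); lia.
Qed.

End Comb.

Theorem theorem2p5 (n : nat) (hn : 4 <= n) :
  is_chi_la (corona (path_graph n) (complete_graph 1)) (n + 2).
Proof.
case: n hn => // m hm; rewrite addn2; split; last first.
  by move=> f; apply: num_colors_comb_ge.
exists (@comb_labeling m); first exact: comb_labeling_antimagic.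
(* The lower bound, applied to this very labeling, turns its color bound into an equality. *)
apply/eqP; rewrite eqn_leq num_colors_comb_labeling //=.
exact/num_colors_comb_ge/comb_labeling_antimagic.
Qed.
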